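(* The real Banach space $C[0,1]$ (continuous real-valued functions on $[0,1]$ with the supremum norm) has property (P3) but fails property (P2).
   Context: For a Banach space $Z$ with closed unit ball $B_Z$, unit sphere $S_Z$, dual $Z^\ast$ and dual unit sphere $S_{Z^\ast}$, a slice of $B_Z$ is a set of the form $S(z^\ast,\alpha)=\{z\in B_Z\colon z^\ast(z)>1-\alpha\}$ with $z^\ast\in S_{Z^\ast}$ and $\alpha>0$. A convex combination of slices of $B_Z$ is a set of the form $\sum_{i=1}^n\lambda_iS_i=\{\sum_{i=1}^n\lambda_i s_i\colon s_i\in S_i\}$, where $n\in\mathbb{N}$, $\lambda_1,\dotsc,\lambda_n\geq 0$, $\sum_{i=1}^n\lambda_i=1$, and $S_1,\dotsc,S_n$ are slices of $B_Z$. Property (P2) of $Z$: every convex combination of slices of $B_Z$ has nonempty interior in the relative weak topology of $B_Z$. Property (P3) of $Z$: every convex combination of slices of $B_Z$ intersects the unit sphere $S_Z$. *)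

(* Defs.v *)
From HB Require Import structures.
From mathcomp Require Import all_boot all_order all_algebra.
From mathcomp Require Import all_classical all_reals all_analysis.
From mathcomp Require Import ring lra.

Set Implicit Arguments.
Unset Strict Implicit.
Unset Printing Implicit Defensive.

Import Order.TTheory GRing.Theory Num.Theory.
Import numFieldNormedType.Exports.

Local Open Scope classical_set_scope.
Local Open Scope ring_scope.

Section Banach.
Context {R : realType} (Z : completeNormedModType R).

Definition unit_ball : set Z := [set z | `|z| <= 1].

Definition unit_sphere : set Z := [set z | `|z| = 1].

Definition dual : set {linear Z -> R^o} := [set f | continuous f].

(* [sup] is the real-valued supremum (0 on unbounded sets); it is a genuine
   supremum for every continuous [f], and is only used on [dual]. *)
Definition dual_norm (f : {linear Z -> R^o}) : R :=
  sup [set `|f z| | z in unit_ball].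

Definition dual_unit_sphere : set {linear Z -> R^o} :=
  [set f | dual f /\ dual_norm f = 1].

Definition slice (f : {linear Z -> R^o}) (a : R) : set Z :=
  [set z | unit_ball z /\ f z > 1 - a].

Definition is_slice (S : set Z) : Prop :=
  exists f a, [/\ dual_unit_sphere f, 0 < a & S = slice f a].

Definition convex_combination n (l : 'I_n -> R) (S : 'I_n -> set Z) : set Z :=
  [set \sum_(i < n) l i *: s i | s in [set s : 'I_n -> Z | forall i, S i (s i)]].

Definition is_convex_combination_of_slices (C : set Z) : Prop :=
  exists n (l : 'I_n -> R) (S : 'I_n -> set Z),
    [/\ forall i, 0 <= l i, \sum_(i < n) l i = 1, forall i, is_slice (S i)
      & C = convex_combination l S].

Definition weak_topology : topologicalType :=
  sup_topology (fun f : dual =>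
    Topological.class (initial_topology (\val f : Z -> R^o))).

(* The coercion of the set to a type carries the subspace topology. *)
Definition weak_unit_ball : topologicalType :=
  (unit_ball : set weak_topology).

Definition property_P2 : Prop :=
  forall C : set Z, is_convex_combination_of_slices C ->
    [set z : weak_unit_ball | C (\val z)]° !=set0.

Definition property_P3 : Prop :=
  forall C : set Z, is_convex_combination_of_slices C ->
    C `&` unit_sphere !=set0.

End Banach.

Definition C01 (R : realType) : Type :=
  continuousType (`[0, 1]%classic : set R) R^o.

Section C01_module.
Context {R : realType}.
Local Notation I := (set_type (`[0, 1]%classic : set R)).

HB.instance Definition _ := Choice.on (C01 R).

Definition continuous_pred : {pred I -> R^o} :=
  mem [set f : I -> R^o | continuous f].

Section Sub.
Context (f : I -> R^o) (fP : f \in continuous_pred).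
Definition C01_Sub : C01 R := mkcts (set_mem fP).
End Sub.

Lemma C01_rect (K : C01 R -> Type) :
  (forall f (Pf : f \in continuous_pred), K (C01_Sub Pf)) -> forall u, K u.
Proof.
move=> Ksub [f [[Pf]]].
have -> : Pf = set_mem (@mem_set _ [set f : I -> R^o | continuous f] f Pf) by [].
exact: Ksub.
Qed.

Lemma C01_valP f (Pf : f \in continuous_pred) : C01_Sub Pf = f :> (I -> R^o).
Proof. by []. Qed.

HB.instance Definition _ := isSub.Build _ _ (C01 R) C01_rect C01_valP.

Lemma continuous_submod_closed : submod_closed continuous_pred.
Proof.
split; first by apply/mem_set => x; exact: (@cst_continuous I R^o 0 x).
move=> a f g /set_mem cf /set_mem cg; apply/mem_set => x.
have ca : (a *: f) @ x --> ((a *: f) x : R^o) by exact: cvgZl_tmp (cf x).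
exact: cvgD ca (cg x).
Qed.

HB.instance Definition _ :=
  GRing.isSubmodClosed.Build R (I -> R^o) continuous_pred
    continuous_submod_closed.

HB.instance Definition _ := [SubChoice_isSubLmodule of C01 R by <:].
End C01_module.

Section C01_norm.
Context {R : realType}.
Implicit Types f g : C01 R.
Local Notation I := (set_type (`[0, 1]%classic : set R)).

Definition sup_norm f : R := sup [set `|f x| | x in [set: I]].

Lemma C01_continuous f : continuous (f : I -> R^o).
Proof. exact: cts_fun. Qed.

Let I0 : I.
Proof. by exists 0; apply/mem_set; rewrite /= in_itv/= lexx ler01. Defined.

Lemma has_sup_C01 f : has_sup [set `|f x| | x in [set: I]].
Proof.
split; first by exists `|f I0|, I0.
pose g : R -> R^o := valL_ (0 : R^o) (f : I -> R^o).
have cg : {within `[0, 1], continuous g}.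
  exact/subspace_valL_continuousP'/C01_continuous.
have gE (x : I) : g (\val x) = f x.
  by have /(congr1 (fun h => h x)) := valLK (0 : R^o) (f : I -> R^o).
have [M _ gM] := EVT_max ler01 cg.
have [m _ gm] := EVT_min ler01 cg.
exists (`|g M| + `|g m|) => _ [x _ <-].
have x01 : \val x \in `[0, 1]%R by have := valP x; rewrite inE.
have := gM _ x01; have := gm _ x01; rewrite gE => h1 h2.
have := ler_norm (g M); have := ler_norm (- g m); rewrite normrN => h3 h4.
have := normr_ge0 (g M); have := normr_ge0 (g m) => h5 h6.
by rewrite ler_norml; apply/andP; split; lra.
Qed.

Lemma sup_norm_ub f x : `|f x| <= sup_norm f.
Proof. by apply: ub_le_sup; [case: (has_sup_C01 f) | exists x]. Qed.

Lemma sup_norm_le f a : (forall x, `|f x| <= a) -> sup_norm f <= a.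
Proof.
move=> fa; apply: ge_sup; first by case: (has_sup_C01 f).
by move=> _ [x _ <-]; exact: fa.
Qed.

Lemma sup_normD f g : sup_norm (f + g) <= sup_norm f + sup_norm g.
Proof.
apply: sup_norm_le => x.
by apply: le_trans (ler_normD _ _) _; apply: lerD; exact: sup_norm_ub.
Qed.

Lemma sup_normZ (a : R) f : sup_norm (a *: f) = `|a| * sup_norm f.
Proof.
have le b h : sup_norm (b *: h) <= `|b| * sup_norm h.
  apply: sup_norm_le => x.
  have -> : (b *: h) x = b * h x by [].
  by rewrite normrM ler_wpM2l// sup_norm_ub.
apply/eqP; rewrite eq_le le/=.
have [->|a0] := eqVneq a 0.
  by rewrite normr0 mul0r; apply: le_trans (sup_norm_ub _ I0).
have := le a^-1 (a *: f).
by rewrite scalerA mulVf// scale1r normfV ler_pdivlMl// normr_gt0.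
Qed.

Lemma sup_norm_eq0 f : sup_norm f = 0 -> f = 0.
Proof.
move=> f0; apply: val_inj; apply/funext => x.
by apply/eqP; rewrite -normr_le0; have := sup_norm_ub f x; rewrite f0.
Qed.

HB.instance Definition _ := Lmodule_isNormed.Build R (C01 R)
  sup_normD sup_normZ sup_norm_eq0.

Lemma C01_normE f : `|f| = sup [set `|f x| | x in [set: I]].
Proof. by []. Qed.

Lemma C01_complete (F : set_system (C01 R)) :
  ProperFilter F -> cauchy F -> cvg F.
Proof.
move=> FF /cauchy_ballP Fc.
have cF e : 0 < e ->
      \forall p \near (F, F), forall x : I, `|(p.1 : C01 R) x - (p.2 : C01 R) x| <= e.
  move=> e0; have := Fc e e0; rewrite !near_simpl; apply: filterS => -[f g]/=.
  rewrite -ball_normE/= => fg x.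
  exact: le_trans (sup_norm_ub (f - g) x) (ltW fg).
have pc x : cvg ((fun f : C01 R => (f x : R^o)) @ F).
  apply: cauchy_cvg; apply/cauchy_ballP => e e0.
  rewrite !near_simpl near_map2.
  have := cF (e / 2) (divr_gt0 e0 (ltr0n _ 2)); apply: filterS => -[f g]/=.
  move=> /(_ x) fg; rewrite -ball_normE/=; apply: le_lt_trans fg _.
  by rewrite ltr_pdivrMr// ltr_pMr// ltr1n.
pose l (x : I) : R^o := lim ((fun f : C01 R => (f x : R^o)) @ F).
have lE e : 0 < e ->
      \forall f \near F, forall x : I, `|(f : C01 R) x - l x| <= e.
  move=> e0.
  have := cF (e / 2) (divr_gt0 e0 (ltr0n _ 2)).
  move=> [[P Q] [FP FQ] PQ]; apply: filterS FP => f Pf x.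
  have e20 : 0 < e / 2 by rewrite divr_gt0.
  have /cvgrPdist_le/(_ _ e20) lx := pc x.
  have [g [gl Qg]] := filter_ex (filterI lx FQ).
  have /= := PQ (f, g) (conj Pf Qg) => /(_ x) fg.
  have -> : f x - l x = (f x - g x) + (g x - l x) by rewrite addrA subrK.
  apply: le_trans (ler_normD _ _) _.
  by rewrite [leRHS]splitr lerD// distrC.
have lc : continuous l.
  move=> x; apply/(@cvgrPdist_le R R^o I _ (nbhs_filter x)) => e e0.
  have e30 : 0 < e / 3 by rewrite divr_gt0.
  have [f fl] := filter_ex (lE _ e30).
  have /(_ _ e30) := (@cvgrPdist_le R R^o I _ (nbhs_filter x) _ _).1
    (@C01_continuous f x).
  apply: (@filterS _ _ (nbhs_filter x)) => y fxy.
  have -> : l x - l y = - (f x - l x) + (f x - f y) + (f y - l y) by ring.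
  apply: le_trans (ler_normD _ _) _.
  have := ler_normD (- (f x - l x)) (f x - f y); rewrite normrN.
  by have := fl x; have := fl y; lra.
have lP : l \in continuous_pred by exact/mem_set.
apply/cvg_ex; exists (C01_Sub lP); apply/cvgrPdist_le => e e0.
near=> f; rewrite distrC; apply: sup_norm_le => x.
by move: x; near: f; exact: lE.
Unshelve. all: by end_near. Qed.

HB.instance Definition _ := Uniform_isComplete.Build (C01 R) C01_complete.
End C01_norm.

(* Main.v *)
(* Fix N disjoint cells in [0, 1] and, on each of them, a plateau function with
   values in [0, 1].

   (P3): replacing s by s + phi (1 - s), with phi a plateau function, keeps s in
   the unit ball and makes it equal to 1 at the centre of the cell. For a
   functional f of norm one, the numbers |f (phi (1 - s))| have sum at most 2
   over the N cells, so for N large some cell suits all the slices at once.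

   Failure of (P2): let f be the Lebesgue integral and C be the half-sum of the
   slices S(f, 1/16) and S(-f, 1/16). A nonempty relatively weakly open set
   contains a z that is constantly 1 or -1 on the plateaus of all but boundedly
   many of the N cells. If z = (x + y) / 2 with x and y in the unit ball, then
   x = y wherever |z| = 1, which forces f x - f y <= 2 - 1/8 for N large,
   whereas f x - f y > 2 - 1/8 if x and y come from the two slices. *)
Require Import Defs.
From HB Require Import structures.
From mathcomp Require Import all_boot all_order all_algebra.
From mathcomp Require Import all_classical all_reals all_analysis.
From mathcomp Require Import ring lra zify.

Set Implicit Arguments.
Unset Strict Implicit.
Unset Printing Implicit Defensive.

Import Order.TTheory GRing.Theory Num.Theory.
Import numFieldNormedType.Exports.

Local Open Scope classical_set_scope.
Local Open Scope ring_scope.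

(** * Extreme points of the fibres of a linear map on the cube *)

(** Follow the line from [c] in direction [u] until the first moving coordinate meets the boundary;
    up to that time no coordinate has left the cube. *)
Lemma slide_to_face (R : realFieldType) N (c u : 'rV[R]_N) :
  u != 0 -> (forall k, `|c 0 k| <= 1) ->
  (forall k, u 0 k != 0 -> `|c 0 k| < 1) ->
  exists t, (forall k, `|(c + t *: u) 0 k| <= 1) /\
    exists2 k, u 0 k != 0 & `|(c + t *: u) 0 k| = 1.
Proof.
move=> /rV0Pn[k0 uk0] c1 cu.
(* [T k] is the time at which coordinate [k] reaches the boundary. *)
pose T k := (1 - Num.sg (u 0 k) * c 0 k) / `|u 0 k|.
have [k uk Tmin] := arg_minP (P := fun k => u 0 k != 0) T uk0.
have cE j : u 0 j != 0 -> Num.sg (u 0 j) * c 0 j <= 1 /\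
    - (Num.sg (u 0 j) * c 0 j) <= 1.
  move=> /cu; rewrite ltr_norml => /andP[? ?].
  by have [_|_|_] := sgrP (u 0 j); split; lra.
have T0 : 0 <= T k.
  by apply: divr_ge0 => //; have [] := cE _ uk; lra.
exists (T k); split.
  move=> j; rewrite !mxE; have [->|uj] := eqVneq (u 0 j) 0.
    by rewrite mulr0 addr0.
  have uj0 : 0 < `|u 0 j| by rewrite normr_gt0.
  have h1 : T k * `|u 0 j| <= 1 - Num.sg (u 0 j) * c 0 j.
    by rewrite -ler_pdivlMr//; exact: Tmin.
  have h2 : 0 <= T k * `|u 0 j| by rewrite mulr_ge0.
  have [h3 h4] := cE _ uj.
  move: h1 h2 h3 h4; rewrite ler_norml; move: uj0 => _.
  by have [|u0|u0] := sgrP (u 0 j); rewrite ?mul1r ?mulN1r; nra.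
exists k => //; rewrite !mxE /T.
have [u0|u0|u0] := sgrP (u 0 k).
- by rewrite u0 eqxx in uk.
- by rewrite mul1r divfK ?gt_eqF// addrC subrK normr1.
- have -> : c 0 k + (1 - -1 * c 0 k) / - u 0 k * u 0 k = -1.
    by field; rewrite lt_eqF.
  by rewrite normrN1.
Qed.

Lemma supported_left_kernel (R : fieldType) N m (A : 'M[R]_(N, m))
    (F : {set 'I_N}) : (m < #|F|)%N ->
  exists u : 'rV_N, [/\ u != 0, u *m A = 0 & forall k, u 0 k != 0 -> k \in F].
Proof.
(* [P] selects the rows of [A] indexed by [F]: more rows than columns, hence a dependence [v], which
   [v *m P] extends by zero. *)
move=> mF; pose P : 'M[R]_(#|F|, N) := \matrix_(i, k) (enum_val i == k)%:R.
have /rowV0Pn[v] : kermx (P *m A) != 0.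
  rewrite kermx_eq0 /row_free neq_ltn; apply/orP; left.
  exact: leq_ltn_trans (rank_leq_col _) mF.
move=> /sub_kermxP vPA v0; exists (v *m P).
have vP i : (v *m P) 0 (enum_val i) = v 0 i.
  rewrite mxE (bigD1 i)//= mxE eqxx mulr1 big1 ?addr0// => j ji.
  by rewrite mxE (inj_eq enum_val_inj) (negPf ji) mulr0.
split; first 2 last.
- move=> k; apply: contraR => kF; rewrite mxE big1// => i _.
  rewrite mxE; case: eqP => [ik|_]; last by rewrite mulr0.
  by rewrite -ik enum_valP in kF.
- have /rV0Pn[i vi] := v0; apply/rV0Pn.
  by exists (enum_val i); rewrite vP.
- by rewrite -mulmxA.
Qed.

(** While more than [m] coordinates lie strictly inside (-1, 1), some kernel direction is supported
    on them; sliding along it preserves the image under [A] and lowers their number. *)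
Lemma cube_fiber_extreme (R : realFieldType) N m (A : 'M[R]_(N, m))
    (c : 'rV[R]_N) : (forall k, `|c 0 k| <= 1) ->
  exists c' : 'rV[R]_N, [/\ forall k, `|c' 0 k| <= 1, c' *m A = c *m A &
    (#|finset (fun k => `|c' 0 k| < 1)%R| <= m)%N].
Proof.
have [n] := ubnP #|finset (fun k => `|c 0 k| < 1)%R|.
elim: n c => // n IH c cn c1.
have [|mF] := leqP #|finset (fun k => `|c 0 k| < 1)%R| m; first by exists c.
have [u [u0 uA uF]] := supported_left_kernel A mF.
have cu k : u 0 k != 0 -> `|c 0 k| < 1 by move=> /uF; rewrite inE.
have [t [ct1 [k uk ctk]]] := slide_to_face u0 c1 cu.
have [|//|c' [c'1 c'A c'm]] := IH (c + t *: u).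
  rewrite -ltnS; apply: leq_trans cn; rewrite ltnS; apply: proper_card.
  apply/properP; split.
    apply/fintype.subsetP => j; rewrite !inE => ctj.
    have [uj|] := eqVneq (u 0 j) 0; last exact: cu.
    by move: ctj; rewrite !mxE uj mulr0 addr0.
  by exists k; rewrite inE ?cu// ctk ltxx.
by exists c'; split=> //; rewrite c'A mulmxDl -scalemxAl uA scaler0 addr0.
Qed.

(** * The space C[0, 1] and its plateau functions *)

Lemma C01_scaleE (R : realType) (a : R) (f : C01 R) t : (a *: f) t = a * f t.
Proof. by []. Qed.

Lemma C01_sumE (R : realType) (J : Type) (r : seq J) (P : pred J)
    (F : J -> C01 R) t :
  (\sum_(i <- r | P i) F i) t = \sum_(i <- r | P i) F i t.
Proof. by elim/big_rec2: _ => // i y x _ <-. Qed.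

Lemma C01_norm_ub (R : realType) (f : C01 R) t : `|f t| <= `|f|.
Proof. exact: sup_norm_ub. Qed.

Lemma C01_norm_le (R : realType) (f : C01 R) a :
  (forall t, `|f t| <= a) -> `|f| <= a.
Proof. exact: sup_norm_le. Qed.

Section C01_mul.
Context (R : realType) (f g : C01 R).
Local Notation I := (set_type (`[0, 1]%classic : set R)).

Lemma C01_mul_subproof : (f : I -> R^o) \* g \in continuous_pred.
Proof.
apply/mem_set => x.
exact: (@cvgM _ _ _ (nbhs_filter x) _ _ _ _
  (@C01_continuous _ f x) (@C01_continuous _ g x)).
Qed.

Definition C01_mul : C01 R := C01_Sub C01_mul_subproof.

Lemma C01_mulE t : C01_mul t = f t * g t.
Proof. by []. Qed.
End C01_mul.

Section C01_restrict.
Context (R : realType) (h : R -> R^o) (ch : continuous h).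
Local Notation I := (set_type (`[0, 1]%classic : set R)).

Lemma C01_restrict_subproof : (h \o \val : I -> R^o) \in continuous_pred.
Proof.
apply/mem_set => x; apply: continuous_comp; last exact: ch.
exact: (@initial_continuous I R \val).
Qed.

Definition C01_restrict : C01 R := C01_Sub C01_restrict_subproof.

Lemma C01_restrictE t : C01_restrict t = h (\val t).
Proof. by []. Qed.
End C01_restrict.

Definition C01_one (R : realType) : C01 R :=
  C01_restrict (@cst_continuous R R^o 1).

(** * Retraction of the line onto the unit segment, and uniform continuity *)

Section clamp.
Context (R : realType).
Local Notation I := (set_type (`[0, 1]%classic : set R)).

Lemma clamp_subproof (x : R) : Num.max 0 (Num.min 1 x) \in `[0, 1]%classic.
Proof.
apply/mem_set; rewrite /= in_itv/= le_max lexx/=.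
by rewrite ge_max ler01 ge_min lexx.
Qed.

(** Composing with this retraction turns an element of [C01 R], defined on a subtype, into a
    continuous function on [R], ready for compactness and integration. *)
Definition clamp (x : R) : I := SigSub (clamp_subproof x).

Lemma val_clamp x : 0 <= x <= 1 -> \val (clamp x) = x.
Proof. by move=> /andP[x0 x1]; rewrite /= min_r// max_r. Qed.

Lemma clampK (t : I) : clamp (\val t) = t.
Proof.
apply: val_inj; apply: val_clamp.
by have := set_mem (valP t); rewrite /= in_itv.
Qed.

Lemma continuous_clamp : continuous clamp.
Proof.
apply: (@continuous_comp_initial I R R \val) => x.
apply: (@continuous_max _ R (cst 0)); first exact: cst_continuous.
by apply: (@continuous_min _ R (cst 1)); [exact: cst_continuous|].
Qed.

Lemma continuous_C01_clamp (f : C01 R) : continuous (f \o clamp : R -> R^o).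
Proof.
move=> x; apply: continuous_comp; first exact: continuous_clamp.
exact: C01_continuous.
Qed.
End clamp.

(** Heine's theorem by the near-covering form of compactness: all small [d] work near each point,
    hence all small [d] work on the whole segment. *)
Lemma C01_unif_continuous (R : realType) (f : C01 R) (e : R) : 0 < e ->
  exists2 d : R, 0 < d & forall s t,
    `|\val s - \val t| < d -> `|f s - f t| < e.
Proof.
move=> e0; pose P (d : R) (x : R) := forall y, `|x - y| < d ->
  `|f (clamp x) - f (clamp y)| < e.
have : \forall d \near 0^'+, `[0 : R, 1]%classic `<=` P d.
  move/compact_near_coveringP : (@segment_compact R 0 1); apply => x _.
  have e20 : 0 < e / 2 by rewrite divr_gt0.
  have /cvgrPdist_lt/(_ _ e20)/nbhs_ballP[r /= r0 xr] :=
    @continuous_C01_clamp R f x.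
  have r20 : 0 < r / 2 by rewrite divr_gt0.
  exists (ball x (r / 2), [set d | d < r / 2]) => /=.
    split; first exact: nbhsx_ballx.
    exact: nbhs_right_lt.
  move=> [x' d]/= []; rewrite -ball_normE/= => xx' dr y x'y.
  have := xr x'; have := xr y; rewrite -ball_normE/=.
  have xy : `|x - y| < r.
    rewrite (_ : x - y = (x - x') + (x' - y)); last by ring.
    by apply: le_lt_trans (ler_normD _ _) _; lra.
  have xx'r : `|x - x'| < r by lra.
  move=> /(_ xy) h1 /(_ xx'r) h2.
  rewrite (_ : _ - _ = - (f (clamp x) - f (clamp x')) +
                       (f (clamp x) - f (clamp y))); last by ring.
  by apply: le_lt_trans (ler_normD _ _) _; rewrite normrN; lra.
move=> /(filterI (nbhs_right_gt 0))/filter_ex[d [/= d0 Pd]].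
exists d => // s t st.
have := Pd (\val s) (set_mem (valP s)) _ st.
by rewrite !clampK.
Qed.

(** * Plateau and tent functions of the cells *)

Section plateau.
Context (R : realType) (N : nat).
Local Notation I := (set_type (`[0, 1]%classic : set R)).

(* Normalised distance to the centre of the cell [k/N, (k+1)/N]: it is 1 at the
   two ends of the cell. *)
Definition cell_dist (k : nat) (t : R) : R :=
  `|2 * N%:R * t - (2 * k%:R + 1)|.

(** For positive [N]: 1 on the middle half of the cell, 0 outside the cell, affine in between. *)
Definition plateau_fun (k : nat) (t : R) : R^o :=
  Num.max 0 (Num.min 1 (2 - 2 * cell_dist k t)).

(** Peak 1 at the centre, and positive only where the plateau function equals 1. *)
Definition tent_fun (k : nat) (t : R) : R^o :=
  Num.max 0 (1 - 2 * cell_dist k t).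

Lemma continuous_affine_cell_dist (a b : R) k :
  continuous ((fun t => a - b * cell_dist k t) : R -> R^o).
Proof.
move=> t; apply: cvgB; first exact: cvg_cst.
apply: cvgM; first exact: cvg_cst.
apply: cvg_norm; apply: cvgB; last exact: cvg_cst.
by apply: cvgM; [exact: cvg_cst|exact: cvg_id].
Qed.

Lemma continuous_plateau_fun k : continuous (plateau_fun k).
Proof.
move=> t; apply: (@continuous_max _ R (cst 0)
  (fun t => Num.min 1 (2 - 2 * cell_dist k t))); first exact: cst_continuous.
apply: (@continuous_min _ R (cst 1) (fun t => 2 - 2 * cell_dist k t)).
  exact: cst_continuous.
exact: continuous_affine_cell_dist.
Qed.

Lemma continuous_tent_fun k : continuous (tent_fun k).
Proof.
move=> t; apply: (@continuous_max _ R (cst 0) (fun t => 1 - 2 * cell_dist k t)).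
  exact: cst_continuous.
exact: continuous_affine_cell_dist.
Qed.

Definition plateau k : C01 R := C01_restrict (@continuous_plateau_fun k).
Definition tent k : C01 R := C01_restrict (@continuous_tent_fun k).

Lemma plateau_ge0 k t : 0 <= plateau k t.
Proof. by rewrite C01_restrictE /plateau_fun le_max lexx. Qed.

Lemma plateau_le1 k t : plateau k t <= 1.
Proof. by rewrite C01_restrictE /plateau_fun ge_max ler01 ge_min lexx. Qed.

Lemma tent_ge0 k t : 0 <= tent k t.
Proof. by rewrite C01_restrictE /tent_fun le_max lexx. Qed.

Lemma tent_le_plateau k t : tent k t <= plateau k t.
Proof.
rewrite !C01_restrictE /tent_fun /plateau_fun.
have : 0 <= cell_dist k (\val t) by exact: normr_ge0.
by rewrite /Num.max /Num.min; do ?case: ifPn; rewrite -?leNgt; lra.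
Qed.

Lemma tent_gt0_plateau k t : 0 < tent k t -> plateau k t = 1.
Proof.
rewrite !C01_restrictE /tent_fun /plateau_fun lt_max ltxx/= => h.
by rewrite min_l ?max_r//; lra.
Qed.

Lemma plateau_neq0 k t : plateau k t != 0 -> cell_dist k (\val t) < 1.
Proof.
apply: contra_neqT; rewrite -leNgt C01_restrictE /plateau_fun => h.
by apply: max_l; rewrite ge_min; apply/orP; right; lra.
Qed.

(** Otherwise [2 * N%:R * t] would be at distance less than 1 from two distinct odd integers. *)
Lemma cell_dist_inj k j t : cell_dist k t < 1 -> cell_dist j t < 1 -> k = j.
Proof.
rewrite /cell_dist !ltr_norml => /andP[? ?] /andP[? ?].
have kj : k%:R < j.+1%:R :> R by rewrite -natr1; lra.
have jk : j%:R < k.+1%:R :> R by rewrite -natr1; lra.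
by move: kj jk; rewrite !ltr_nat !ltnS => kj jk; apply/eqP; rewrite eqn_leq kj.
Qed.

Lemma sum_plateau_le1 t : \sum_(k < N) plateau k t <= 1.
Proof.
have [[k pk]|pN] := pselect (exists k : 'I_N, plateau k t != 0); last first.
  rewrite big1 ?ler01// => k _; apply/eqP/negPn/negP => pk.
  by apply: pN; exists k.
rewrite (bigD1 k)//= big1 ?addr0 ?plateau_le1// => j jk.
apply/eqP; apply: contraNT jk => pj.
by apply/eqP/val_inj; apply: (@cell_dist_inj _ _ (\val t)); exact: plateau_neq0.
Qed.

Lemma plateau_eq1 (k j : 'I_N) t : plateau k t = 1 -> j != k -> plateau j t = 0.
Proof.
move=> k1; apply: contra_neq_eq => pj; apply: val_inj.
apply: (@cell_dist_inj _ _ (\val t)); apply: plateau_neq0 => //.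
by rewrite k1 oner_neq0.
Qed.

Definition cell_center (k : 'I_N) : I := clamp ((2 * k%:R + 1) / (2 * N%:R)).

Lemma ordinal_natr_gt0 (k : 'I_N) : 0 < N%:R :> R.
Proof. by rewrite ltr0n (leq_ltn_trans _ (ltn_ord k)). Qed.

Lemma val_cell_center (k : 'I_N) :
  \val (cell_center k) = (2 * k%:R + 1) / (2 * N%:R).
Proof.
have N0 := ordinal_natr_gt0 k.
have kN : k%:R + 1 <= N%:R :> R by rewrite natr1 ler_nat ltn_ord.
have k0 : 0 <= k%:R :> R by [].
apply: val_clamp; apply/andP; split; first by apply: divr_ge0; lra.
by rewrite ler_pdivrMr; lra.
Qed.

Lemma plateau_center (k : 'I_N) : plateau k (cell_center k) = 1.
Proof.
have N0 := ordinal_natr_gt0 k.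
rewrite C01_restrictE val_cell_center /plateau_fun /cell_dist.
rewrite [2 * N%:R * _]mulrC divfK; last by rewrite mulf_neq0 ?gt_eqF.
by rewrite subrr normr0 min_l ?max_r//; lra.
Qed.

Lemma plateau_near_center (k : 'I_N) t :
  plateau k t != 0 -> `|\val t - \val (cell_center k)| < N%:R^-1.
Proof.
have N0 := ordinal_natr_gt0 k.
move=> /plateau_neq0; rewrite val_cell_center /cell_dist => h.
have -> : \val t - (2 * k%:R + 1) / (2 * N%:R) =
    (2 * N%:R * \val t - (2 * k%:R + 1)) / (2 * N%:R).
  by field; rewrite gt_eqF.
rewrite normrM normfV (gtr0_norm (_ : 0 < 2 * N%:R)); last lra.
rewrite ltr_pdivrMr; last lra.
by rewrite mulrCA mulVf ?gt_eqF// mulr1; lra.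
Qed.
End plateau.

(** * Norm-one functionals and the Lebesgue integral *)

Section dual_sphere.
Context (R : realType) (Z : completeNormedModType R) (f : {linear Z -> R^o}).
Hypothesis fS : dual_unit_sphere f.

(** Without a genuine supremum, [sup] would take its default value 0 instead of 1. *)
Lemma dual_unit_sphere_has_sup : has_sup [set `|f z| | z in @unit_ball R Z].
Proof.
apply: contrapT => /sup_out f0; case: fS => _.
by rewrite /dual_norm f0 => /eqP; rewrite eq_sym oner_eq0.
Qed.

Lemma dual_unit_sphere_le z : `|f z| <= `|z|.
Proof.
have [->|z0] := eqVneq z 0; first by rewrite linear0 !normr0 lexx.
have nz : 0 < `|z| by rewrite normr_gt0.
rewrite -[leRHS]mul1r -ler_pdivrMr//.
rewrite -[`|f z| / _](_ : `|f (`|z|^-1 *: z)| = _); last first.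
  by rewrite linearZ/= normrM normfV normr_id mulrC.
case: fS => _ <-; apply: ub_le_sup; first by case: dual_unit_sphere_has_sup.
exists (`|z|^-1 *: z) => //; rewrite /unit_ball/=.
by rewrite normrZ normfV normr_id mulVf// gt_eqF.
Qed.

Lemma slice_nonempty a : 0 < a -> slice f a !=set0.
Proof.
move=> a0; have [_ [z z1 <-]] := sup_adherent a0 dual_unit_sphere_has_sup.
have -> : sup [set `|f z| | z in @unit_ball R Z] = 1 by case: fS.
(* The norm is a supremum of absolute values, so [z] may have to be replaced by [- z]. *)
have [fz|fz] := ger0P (f z) => h; first by exists z.
by exists (- z); split; rewrite /unit_ball/= ?normrN// linearN.
Qed.
End dual_sphere.

Section lebesgue_functional.
Context (R : realType).
Let mu := @lebesgue_measure R.
Implicit Types f g : C01 R.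

Definition integral01 f : R^o := \int[mu]_(x in `[0, 1]) f (clamp x).

Lemma integrable_clamp f :
  mu.-integrable `[0, 1] (EFin \o (fun x => f (clamp x))).
Proof.
apply: continuous_compact_integrable; first exact: segment_compact.
exact/continuous_subspaceT/continuous_C01_clamp.
Qed.

Lemma integral01_linear : linear integral01.
Proof.
move=> a f g; rewrite /integral01.
rewrite [LHS](_ : _ =
    \int[mu]_(x in `[0, 1]) (a * f (clamp x) + g (clamp x)))//.
rewrite RintegralD ?RintegralZl//; try exact: integrable_clamp.
exact: (integrable_clamp (a *: f)).
Qed.

HB.instance Definition _ :=
  GRing.isLinear.Build R (C01 R) R^o *:%R integral01 integral01_linear.

Lemma integrable_cst_segment (a b r : R) :
  mu.-integrable `[a, b] (EFin \o cst r).
Proof.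
apply: continuous_compact_integrable; first exact: segment_compact.
exact/continuous_subspaceT/cst_continuous.
Qed.

Lemma integral01_ub f a : (forall t, f t <= a) -> integral01 f <= a.
Proof.
move=> fa; apply: (@le_trans _ _ (\int[mu]_(x in `[0, 1]) a)).
  apply: le_Rintegral => //; first exact: integrable_clamp.
  exact: integrable_cst_segment.
rewrite Rintegral_cst//= lebesgue_measure_itv/= lte_fin ltr01.
by rewrite oppr0 addr0 mulr1.
Qed.

Lemma integral01_one : integral01 (C01_one R) = 1.
Proof.
rewrite /integral01; rewrite [LHS](_ : _ = \int[mu]_(x in `[0, 1]) 1)//.
rewrite Rintegral_cst//= lebesgue_measure_itv/= lte_fin ltr01.
by rewrite oppr0 addr0 mulr1.
Qed.

Lemma integral01_norm f : `|integral01 f| <= `|f|.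
Proof.
rewrite ler_norml lerNl -linearN; apply/andP; split; apply: integral01_ub => t.
  by rewrite -(normrN f); exact: le_trans (ler_norm _) (C01_norm_ub (- f) t).
exact: le_trans (ler_norm _) (C01_norm_ub f t).
Qed.

Lemma integral01_sphere : dual_unit_sphere integral01.
Proof.
have ub : ubound [set `|integral01 z| | z in @unit_ball R (C01 R)] 1.
  by move=> _ [z z1 <-]; exact: le_trans (integral01_norm z) z1.
split.
  apply/bounded_linear_continuous/linear_boundedP.
  exists 1; split=> // r r1 z.
  by rewrite (le_trans (integral01_norm z))// ler_peMl// ltW.
apply/eqP; rewrite eq_le; apply/andP; split.
  apply: ge_sup => //; exists `|integral01 0|, 0 => //.
  by rewrite /unit_ball/= normr0.
apply: ub_le_sup; first by exists 1.
exists (C01_one R); last first.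
  by rewrite [X in `|X|]integral01_one normr1.
by apply: C01_norm_le => t; rewrite C01_restrictE normr1.
Qed.

(** On the middle quarter [[a, b]] of the cell, of length 1/(4N), the tent is at least 1/2. *)
Lemma integral01_tent N (k : 'I_N) : (8 * N%:R)^-1 <= integral01 (tent R N k).
Proof.
have N0 := ordinal_natr_gt0 R k.
have kN : k%:R + 1 <= N%:R :> R by rewrite natr1 ler_nat ltn_ord.
have k0 : 0 <= k%:R :> R by [].
pose a : R := (2 * k%:R + 3 / 4) / (2 * N%:R).
pose b : R := (2 * k%:R + 5 / 4) / (2 * N%:R).
have a0 : 0 <= a by apply: divr_ge0; lra.
have b1 : b <= 1 by rewrite ler_pdivrMr; lra.
have ab : a < b by rewrite ltr_pM2r ?invr_gt0; lra.
have abE x : a <= x -> x <= b -> 2^-1 <= tent R N k (clamp x).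
  move=> ax xb; rewrite C01_restrictE val_clamp; last by apply/andP; split; lra.
  move: ax xb; rewrite ler_pdivrMr ?ler_pdivlMr; try lra.
  move=> ax xb; rewrite /tent_fun /cell_dist le_max; apply/orP; right.
  have : `|2 * N%:R * x - (2 * k%:R + 1)| <= 4^-1.
    by rewrite ler_norml; apply/andP; split; lra.
  by lra.
have sub : `[a, b]%classic `<=` `[0, 1]%classic.
  by move=> x; rewrite /= !in_itv/= => /andP[? ?]; apply/andP; split; lra.
have iab : mu.-integrable `[a, b] (EFin \o (fun x => tent R N k (clamp x))).
  by apply: integrableS (integrable_clamp _).
apply: (@le_trans _ _ (\int[mu]_(x in `[a, b]) 2^-1)).
  rewrite Rintegral_cst//= lebesgue_measure_itv/= lte_fin ab/=.
  rewrite (_ : 2^-1 * (b - a) = (8 * N%:R)^-1) ?lexx// /a /b.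
  by field; rewrite gt_eqF.
apply: (@le_trans _ _ (\int[mu]_(x in `[a, b]) tent R N k (clamp x))).
  apply: le_Rintegral => //; first exact: integrable_cst_segment.
  by move=> x; rewrite /= in_itv/= => /andP[]; exact: abE.
apply: fine_le.
- exact: integrable_fin_num iab.
- exact: integrable_fin_num (integrable_clamp _).
apply: ge0_subset_integral => //.
  exact: (measurable_int mu (integrable_clamp _)).
by move=> x _; rewrite lee_fin tent_ge0.
Qed.
End lebesgue_functional.

(** Packs a point of the slice, a tolerance and the functional into one triple, so that a single use
    of choice handles a whole family of slices. *)
Lemma slice_stable (R : realType) (Z : completeNormedModType R) (S : set Z) :
  is_slice S ->
  exists p : Z * R * {linear Z -> R^o},
    [/\ `|p.1.1| <= 1, 0 < p.1.2, dual_unit_sphere p.2 &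
    forall g, `|g| <= 1 -> `|p.2 (g - p.1.1)| < p.1.2 -> S g].
Proof.
move=> [f [a [fS a0 ->]]]; have [s [s1 fs]] := slice_nonempty fS a0.
exists (s, f s - (1 - a), f); split=> //=; first by rewrite subr_gt0.
move=> g g1; rewrite linearB ltr_norml => /andP[fg _]; split=> //.
by move: fg; rewrite /=; lra.
Qed.

(** * Property (P3) *)

Section property_P3.
Context (R : realType).
Implicit Types f : {linear C01 R -> R^o}.

(* With signs, the sum is [f] of a signed sum of the [C01_mul (plateau k) h],
   whose norm is at most [`|h|]. *)
Lemma sum_dual_plateau_le f N h : dual_unit_sphere f ->
  \sum_(k < N) `|f (C01_mul (plateau R N k) h)| <= `|h|.
Proof.
move=> fS.
pose v (k : 'I_N) := C01_mul (plateau R N k) h.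
rewrite (_ : \sum_(k < N) _ = f (\sum_(k < N) Num.sg (f (v k)) *: v k)).
  apply: le_trans (ler_norm _) _; apply: le_trans (dual_unit_sphere_le fS _) _.
  apply: C01_norm_le => t; rewrite C01_sumE.
  apply: le_trans (ler_norm_sum _ _ _) _.
  apply: (@le_trans _ _ (\sum_(k < N) plateau R N k t * `|h|)).
    apply: ler_sum => k _; rewrite C01_scaleE /v C01_mulE !normrM.
    rewrite (ger0_norm (plateau_ge0 _ _ _)) -[leRHS]mul1r.
    apply: ler_pM => //; first by rewrite mulr_ge0// plateau_ge0.
      by rewrite normr_sg; case: (_ != 0).
    by rewrite ler_wpM2l ?plateau_ge0 ?C01_norm_ub.
  by rewrite -mulr_suml ler_piMl// sum_plateau_le1.
rewrite linear_sum; apply: eq_bigr => k _.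
by rewrite linearZ/= [LHS]normrEsg.
Qed.

Lemma C01_property_P3 : property_P3 (C01 R).
Proof.
move=> _ [n [l [S [l0 l1 /(_ _)/slice_stable-/choice[p pP] ->]]]].
pose s i := (p i).1.1; pose e i := (p i).1.2; pose f i := (p i).2.
pose h i : C01 R := C01_one R - s i.
have e0 i : 0 < e i by case: (pP i).
have hE i t : h i t = 1 - s i t by [].
have h2 i : `|h i| <= 2.
  apply: C01_norm_le => t; rewrite hE.
  have [s1 _ _ _] := pP i; have := le_trans (C01_norm_ub (s i) t) s1.
  by rewrite !ler_norml => /andP[? ?]; apply/andP; split; lra.
(* Summing [w] over all cells gives at most [B], as each [h i] has norm at most 2. With [N > B],
   some cell has [w k < 1], so each perturbation there stays below its tolerance [e i]. *)
pose B := \sum_(i < n) 2 / e i.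
pose N := (Num.truncn B).+1.
have BN : B < N%:R by exact: truncnS_gt.
pose w (k : 'I_N) := \sum_(i < n) `|f i (C01_mul (plateau R N k) (h i))| / e i.
have [k wk] : exists k, w k < 1.
  apply: contrapT => /forallNP wN; move: BN; rewrite ltNge => /negP; apply.
  rewrite -[N in N%:R]card_ord -sumr_const.
  apply: (@le_trans _ _ (\sum_(k < N) w k)).
    by apply: ler_sum => k _; rewrite leNgt; apply/negP/wN.
  rewrite exchange_big/=; apply: ler_sum => i _.
  rewrite -mulr_suml ler_pM2r ?invr_gt0//.
  by apply: le_trans (sum_dual_plateau_le _ _ _) (h2 i); case: (pP i).
pose g i : C01 R := s i + C01_mul (plateau R N k) (h i).
have gE i t : g i t = s i t + plateau R N k t * (1 - s i t) by [].
have g1 i : `|g i| <= 1.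
  apply: C01_norm_le => t; rewrite gE.
  have [s1 _ _ _] := pP i; have := le_trans (C01_norm_ub (s i) t) s1.
  have := plateau_ge0 N k t; have := plateau_le1 N k t.
  by rewrite !ler_norml => ? ? /andP[? ?]; apply/andP; split; nra.
exists (\sum_(i < n) l i *: g i); split.
  exists g => // i; have [_ _ _] := pP i; apply=> //.
  rewrite /g addrC addKr -/(f i) -/(e i) -[ltRHS]mul1r -ltr_pdivrMr//.
  apply: le_lt_trans wk; rewrite /w (bigD1 i)//= lerDl sumr_ge0// => j _.
  by rewrite divr_ge0// ltW.
apply/eqP; rewrite /unit_sphere/= eq_le; apply/andP; split.
  apply: le_trans (ler_norm_sum _ _ _) _; rewrite -l1; apply: ler_sum => i _.
  by rewrite normrZ ger0_norm// ler_piMr.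
(* Every [g i] equals 1 at this centre, hence so does their convex combination. *)
apply: le_trans (C01_norm_ub _ (cell_center R k)).
rewrite C01_sumE (eq_bigr l) ?l1 ?normr1 ?lexx// => i _.
by rewrite C01_scaleE gE plateau_center mul1r addrC subrK mulr1.
Qed.
End property_P3.

(** * Failure of property (P2) *)

Section weak_neighborhoods.
Context (R : realType) (Z : completeNormedModType R).

(** The sets [V] satisfying the conclusion form a filter; it converges to [z0] in each initial
    topology, hence in their supremum. *)
Lemma weak_nbhs_basis (z0 : Z) (V : set Z) : nbhs (z0 : weak_topology Z) V ->
  exists m (g : 'I_m -> {linear Z -> R^o}) (e : R),
    [/\ forall j, dual (g j), 0 < e &
      forall z, (forall j, `|g j (z - z0)| < e) -> V z].
Proof.
pose F : set_system Z := [set V | exists m (g : 'I_m -> {linear Z -> R^o}) e,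
  [/\ forall j, dual (g j), 0 < e &
    forall z, (forall j, `|g j (z - z0)| < e) -> V z]].
have FF : Filter F.
  split.
  - by exists 0%N, (fun=> \0), 1; split=> //; case.
  - move=> A B [m [g [e [gc e0 gA]]]] [n [h [d [hc d0 hB]]]].
    exists (m + n)%N, (fun j => match fintype.split j with
      | inl i => g i | inr i => h i end), (Num.min e d).
    split; first by move=> j; case: fintype.splitP.
      by rewrite lt_min e0 d0.
    move=> z zgh; split.
      apply: gA => j; have := zgh (lshift n j).
      by rewrite (unsplitK (inl j)) lt_min => /andP[].
    apply: hB => j; have := zgh (rshift m j).
    by rewrite (unsplitK (inr j)) lt_min => /andP[].
  - move=> A B AB [m [g [e [gc e0 gA]]]]; exists m, g, e; split=> // z zg.
    exact/AB/gA.
suff Fz0 : F --> (z0 : weak_topology Z) by exact: Fz0.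
apply/cvg_sup => f A [_ [[B oB <-] Bz0] BA].
have /nbhs_ballP[e /= e0 eB] : nbhs (\val f z0) B by exact: open_nbhs_nbhs.
exists 1%N, (fun=> \val f), e; split=> // [_|z /(_ ord0) zf].
  exact: set_mem (valP f).
apply: BA; apply: eB; rewrite -ball_normE/= distrC.
by move: zf; rewrite linearB.
Qed.

Lemma weak_interior_nonempty (C : set Z) :
  [set z : weak_unit_ball Z | C (\val z)]° !=set0 ->
  exists z0 m (g : 'I_m -> {linear Z -> R^o}) (e : R),
    [/\ `|z0| <= 1, forall j, dual (g j), 0 < e &
      forall z, `|z| <= 1 -> (forall j, `|g j (z - z0)| < e) -> C z].
Proof.
move=> [z0 [_ [[V oV <-] Vz0] VC]].
have /weak_nbhs_basis[m [g [e [gc e0 gV]]]] :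
    nbhs (\val z0 : weak_topology Z) V by exact: open_nbhs_nbhs.
exists (\val z0), m, g, e; split=> //; first exact: set_mem (valP z0).
move=> z z1 /gV Vz.
exact: (VC (SigSub (mem_set z1 : z \in @unit_ball R Z))).
Qed.

Lemma dual_small m (g : 'I_m -> {linear Z -> R^o}) (e : R) :
  (forall j, dual (g j)) -> 0 < e ->
  exists2 d : R, 0 < d & forall w, `|w| <= d -> forall j, `|g j w| < e.
Proof.
move=> gc e0.
have : \forall w \near (0 : Z), forall j, `|g j w| < e.
  apply: filter_forall => j.
  have /cvgrPdist_lt/(_ _ e0) := gc j (0 : Z).
  by apply: filterS => w; rewrite linear0 sub0r normrN.
(* The radius is halved to pass from an open ball to the condition [|w| <= d]. *)
move=> /nbhs_ballP[r /= r0 rg]; exists (r / 2); first by rewrite divr_gt0.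
move=> w wr; apply: rg; rewrite -ball_normE/= sub0r normrN.
by apply: le_lt_trans wr _; lra.
Qed.
End weak_neighborhoods.

Section not_P2.
Context (R : realType).

(* Near [z0], replace [z0] by the constant [c k] on each plateau. The values
   [z0 (cell_center k)] give a small perturbation of [z0]; sliding [c] to an
   extreme point of the fibre of [(g j)] keeps every [g j] fixed and makes all
   but [m] of the constants unimodular. *)
Lemma unimodular_on_plateaus (z0 : C01 R) m (g : 'I_m -> {linear C01 R -> R^o})
    (e : R) :
  `|z0| <= 1 -> (forall j, dual (g j)) -> 0 < e ->
  exists (z : C01 R) N (G : {set 'I_N}),
    [/\ `|z| <= 1, forall j, `|g j (z - z0)| < e,
      (0 < N)%N, (N <= 2 * #|G|)%N &
      forall k t, k \in G -> plateau R N k t = 1 -> `|z t| = 1].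
Proof.
move=> z01 gc e0; have [d d0 dg] := dual_small gc e0.
have [r r0 rz] := C01_unif_continuous z0 d0.
(* The first summand makes a cell shorter than [r]; the second gives [2 * m <= N], so discarding at
   most [m] cells leaves at least half. *)
pose N := ((Num.truncn r^-1).+1 + 2 * m)%N.
have N0 : (0 < N)%N by rewrite /N addSn.
have Nr : N%:R^-1 < r.
  rewrite -[ltRHS]invrK ltf_pV2 ?posrE ?ltr0n ?invr_gt0//.
  apply: lt_le_trans (truncnS_gt _) _.
  by rewrite ler_nat leq_addr.
pose p (k : 'I_N) : C01 R := plateau R N k.
(* Pointwise an average of [z0] and the [c 0 k] with weights given by the plateaus; hence it stays
   in the unit ball when the [c 0 k] lie in [-1, 1]. *)
pose y (c : 'rV[R]_N) : C01 R :=
  (z0 - \sum_k C01_mul (p k) z0) + \sum_k c 0 k *: p k.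
have yE c t : y c t =
    (1 - \sum_k p k t) * z0 t + \sum_k c 0 k * p k t.
  have -> : y c t =
    z0 t - (\sum_k C01_mul (p k) z0) t + (\sum_k c 0 k *: p k) t by [].
  by rewrite !C01_sumE mulrBl mul1r mulr_suml.
have p_ge0 t : 0 <= \sum_k p k t by apply: sumr_ge0 => k _; exact: plateau_ge0.
have p_le1 t : \sum_k p k t <= 1 by exact: sum_plateau_le1.
have z0t t : `|z0 t| <= 1 by exact: le_trans (C01_norm_ub z0 t) z01.
have y1 (c : 'rV[R]_N) : (forall k, `|c 0 k| <= 1) -> `|y c| <= 1.
  move=> c1; apply: C01_norm_le => t; rewrite yE.
  apply: le_trans (ler_normD _ _) _.
  have h1 : `|(1 - \sum_k p k t) * z0 t| <= 1 - \sum_k p k t.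
    by rewrite normrM ger0_norm ?subr_ge0// ler_piMr// subr_ge0.
  have h2 : `|\sum_k c 0 k * p k t| <= \sum_k p k t.
    apply: le_trans (ler_norm_sum _ _ _) _; apply: ler_sum => k _.
    by rewrite normrM (ger0_norm (plateau_ge0 _ _ _)) ler_piMl// plateau_ge0.
  by lra.
pose c0 : 'rV[R]_N := \row_k z0 (cell_center R k).
have c01 k : `|c0 0 k| <= 1 by rewrite mxE.
have yc0 : `|y c0 - z0| <= d.
  apply: C01_norm_le => t.
  have -> : (y c0 - z0) t = y c0 t - z0 t by [].
  rewrite yE (_ : _ - _ = \sum_k (c0 0 k - z0 t) * p k t); last first.
    by under [RHS]eq_bigr do rewrite mulrBl; rewrite sumrB -mulr_sumr; ring.
  apply: le_trans (ler_norm_sum _ _ _) _.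
  apply: (@le_trans _ _ (\sum_k d * p k t)).
    apply: ler_sum => k _; rewrite normrM (ger0_norm (plateau_ge0 _ _ _)).
    have [->|pk] := eqVneq (p k t) 0; first by rewrite !mulr0.
    rewrite ler_wpM2r ?plateau_ge0// mxE distrC ltW// rz//.
    exact: lt_trans (plateau_near_center pk) Nr.
  by rewrite -mulr_sumr ler_piMr// ltW.
pose A : 'M[R]_(N, m) := \matrix_(k, j) g j (p k).
have gy c j : g j (y c) = g j (z0 - \sum_k C01_mul (p k) z0) + (c *m A) 0 j.
  rewrite linearD; congr (_ + _); rewrite linear_sum mxE; apply: eq_bigr => k _.
  by rewrite linearZ mxE.
have [c [c1 cA cm]] := cube_fiber_extreme A c01.
exists (y c), N, (~: finset (fun k => `|c 0 k| < 1)); split=> //.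
- exact: y1.
(* [g j] agrees at [y c] and [y c0], and [y c0] is within [d] of [z0] in norm. *)
- by move=> j; rewrite linearB/= gy cA -gy -linearB; exact: dg.
- have := cardsC (finset (fun k => `|c 0 k| < 1)); rewrite card_ord.
  move: cm (leq_addl _ _ : 2 * m <= N)%N.
  by move: #|~: _| #|_| => b a; lia.
- move=> k t; rewrite !inE -leNgt => ck pk.
  have pj j : j != k -> p j t = 0 by exact: plateau_eq1.
  have -> : y c t = c 0 k.
    have sum_pk : \sum_j p j t = 1.
      by rewrite (bigD1 k)//= big1 ?addr0.
    rewrite yE sum_pk subrr mul0r add0r (bigD1 k)//= big1 ?addr0.
      by rewrite /p pk mulr1.
    by move=> j jk; rewrite pj// mulr0.
  by apply/eqP; rewrite eq_le c1 ck.
Qed.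

Lemma C01_not_P2 : ~ property_P2 (C01 R).
Proof.
pose I01 : {linear C01 R -> R^o} := @integral01 R.
pose f (i : 'I_2) : {linear C01 R -> R^o} := if i == ord0 then I01 else \- I01.
have fS i : dual_unit_sphere (f i).
  rewrite /f; case: ifP => _; first exact: integral01_sphere.
  have [c1 n1] := integral01_sphere R; split.
    by move=> x; exact: cvgN (c1 x).
  rewrite -n1 /dual_norm; congr sup; apply/seteqP.
  by split=> _ [x x1 <-]; exists x => //=; rewrite normrN.
move=> /(_ (convex_combination (fun=> 2^-1) (fun i => slice (f i) (16^-1)))).
case/(_ _)/weak_interior_nonempty.
  exists 2%N, (fun=> 2^-1), (fun i => slice (f i) (16^-1)); split=> //.
  - by rewrite !big_ord_recl big_ord0; lra.
  - by move=> i; exists (f i), 16^-1.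
move=> z0 [m [g [e [z01 gc e0 gC]]]].
have [z [N [G [z1 gz N0 NG zG]]]] := unimodular_on_plateaus z01 gc e0.
have [s sS sz] := gC z z1 gz.
pose x := s ord0; pose y := s (lift ord0 ord0).
have [x1 fx] : `|x| <= 1 /\ 1 - 16^-1 < I01 x := sS ord0.
have [y1 fy] : `|y| <= 1 /\ 1 - 16^-1 < - I01 y := sS (lift ord0 ord0).
have zE t : z t = 2^-1 * x t + 2^-1 * y t.
  by rewrite -sz C01_sumE !big_ord_recl big_ord0 addr0.
(* The tents live where [x] and [y] coincide, so adding them keeps the norm at most 2 while
   increasing the integral. *)
pose w : C01 R := x - y + 2 *: \sum_(k in G) tent R N k.
have wE t : w t = x t - y t + 2 * \sum_(k in G) tent R N k t.
  by rewrite -C01_sumE.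
have w2 : `|w| <= 2.
  apply: C01_norm_le => t; rewrite wE.
  have := le_trans (C01_norm_ub x t) x1; have := le_trans (C01_norm_ub y t) y1.
  rewrite !ler_norml => /andP[yt yt'] /andP[xt xt'].
  have tent1 : 0 <= \sum_(k in G) tent R N k t <= 1.
    rewrite sumr_ge0//=; last by move=> k _; exact: tent_ge0.
    apply: le_trans (sum_plateau_le1 N t); rewrite big_mkcond/=.
    apply: ler_sum => k _.
    by case: ifP => _; [exact: tent_le_plateau|exact: plateau_ge0].
  (* Where a tent is positive, the midpoint [z t] of [x t] and [y t] is 1 or -1, which forces
     [x t = y t] in [-1, 1]. *)
  have [[k [kG tk]]|tG] := pselect (exists k, k \in G /\ 0 < tent R N k t).
    have := zG k t kG (tent_gt0_plateau tk); rewrite zE.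
    have /andP[? ?] := tent1.
    by case: ger0P => ? ?; apply/andP; split; lra.
  rewrite big1 ?mulr0 ?addr0; first by apply/andP; split; lra.
  move=> k kG; apply/eqP; rewrite eq_le tent_ge0 andbT leNgt; apply/negP => tk.
  by apply: tG; exists k.
have : I01 w <= 2.
  exact: le_trans (ler_norm _) (le_trans (integral01_norm w) w2).
have -> : I01 w = I01 x - I01 y + 2 * \sum_(k in G) I01 (tent R N k).
  by rewrite linearD linearB linearZ linear_sum.
have NR : 0 < N%:R :> R by rewrite ltr0n.
(* At least N/2 tents contribute at least 1/(8N) each. This total is the width 1/16 chosen for the
   slices: [I01 x - I01 y] is then at most 2 - 2/16, against the slice conditions. *)
have : 16^-1 <= \sum_(k in G) I01 (tent R N k).
  apply: (@le_trans _ _ (\sum_(k in G) (8 * N%:R)^-1 : R)); last first.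
    by apply: ler_sum => k _; exact: integral01_tent.
  rewrite sumr_const -[_ *+ #|G|]mulr_natr.
  rewrite ler_pdivlMl; last by rewrite mulr_gt0.
  have : N%:R <= 2 * #|G|%:R :> R by rewrite -natrM ler_nat.
  by lra.
by lra.
Qed.
End not_P2.

Theorem corollary3p3 (R : realType) :
  property_P3 (C01 R) /\ ~ property_P2 (C01 R).
Proof. by split; [exact: C01_property_P3|exact: C01_not_P2]. Qed.
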